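(* Let $$V_1=(v_1,v_2,\ldots,v_{m-1},\widetilde{v_m}),\qquad v_i\in\mathcal{R}_+\ \text{ for } i=1,2,\ldots,m,$$ be such that $$V_1(z)\widetilde{V_1}(z)=\sum_{i=1}^m v_i(z)\widetilde{v_i}(z)=1$$ (equivalently, $\sum_{i=1}^m|v_i(t)|^2=1$ for each $t\in\mathbb{T}$). If $$\sum_{i=1}^m|v_i(z)|>0\quad\text{for each } z\in\mathbb{D},$$ then one can precisely construct a paraunitary matrix $V\in\mathcal{R}^{m\times m}$ whose first row is $V_1$.
   Context: $\mathbb{T}=\{z\in\mathbb{C}:|z|=1\}$ and $\mathbb{D}=\{z\in\mathbb{C}:|z|<1\}$. $\mathcal{R}$ is the set of rational functions (of one complex variable, with complex coefficients), and $\mathcal{R}_+\subset\mathcal{R}$ is the set of rational functions all of whose poles lie outside the open disk $\mathbb{D}$ (poles on $\mathbb{T}$ and at $\infty$ are allowed). For $f\in\mathcal{R}$, $\widetilde{f}(z)=\overline{f(1/\overline{z})}$, and for a matrix $G=[G_{ij}]$ with entries in $\mathcal{R}$, $\widetilde{G}=[\widetilde{G_{ji}}]$. A matrix $V\in\mathcal{R}^{m\times m}$ is paraunitary if $V(z)\widetilde{V}(z)=I_m$ (equivalently, $V(z)$ is unitary for each $z\in\mathbb{T}$); identities between rational functions are understood to hold wherever both sides are defined. ''Construct'' means to find the object exactly; constructing a rational function $f$ means determining coprime polynomials $p,q$ with $f=p/q$. Determining coefficients of Laurent expansions and solving systems of linear equations with known coefficients count as exact operations. *)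

(* Defs.v *)
From HB Require Import structures.
From mathcomp Require Import all_boot all_order all_algebra.
From mathcomp Require Import all_reals.
From mathcomp Require Import complex.

Set Implicit Arguments.
Unset Strict Implicit.
Unset Printing Implicit Defensive.

Import Order.TTheory GRing.Theory Num.Theory.

Local Open Scope ring_scope.
Local Open Scope quotient_scope.

Notation ratfun C := {fraction {poly C}}.
Notation "x %:F" := (@FracField.tofrac _ x) : ring_scope.

Section RationalFunctions.
Variable C : numClosedFieldType.
Implicit Types (f : ratfun C) (p q : {poly C}) (z : C).

Definition lowest_terms p q f : Prop :=
  [/\ coprimep p q, q != 0 & f = p%:F / q%:F].

(* [repr f] is an arbitrary representative of the class f, possibly with
   common factors, which have to be cancelled before looking for poles. *)
Definition numf f : {poly C} :=
  let r := repr f in \n_r %/ gcdp \n_r \d_r.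
Definition denf f : {poly C} :=
  let r := repr f in \d_r %/ gcdp \n_r \d_r.

Definition pole f z : Prop := root (denf f) z.

(* The value of f at z, meaningful only when z is not a pole of f. *)
Definition feval f z : C := (numf f).[z] / (denf f).[z].

(* All the poles of f lie outside the open unit disk. *)
Definition Rplus f : Prop := forall z, `|z| < 1 -> ~ pole f z.

(* conj(p(1/conj z)) = \sum_k conj(p`_k) z^-k, as an element of C(z). *)
Definition tilde_poly p : ratfun C :=
  (map_poly (fun a : C => (a^*)%:P%:F) p).[('X%:F)^-1].
Definition tilde f : ratfun C := tilde_poly (numf f) / tilde_poly (denf f).

Definition mxtilde (m n : nat) (G : 'M[ratfun C]_(m, n)) : 'M[ratfun C]_(n, m) :=
  \matrix_(i, j) tilde (G j i).

Definition paraunitary (m : nat) (V : 'M[ratfun C]_m) : Prop :=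
  V *m mxtilde V = 1%:M.

Definition first_row (m : nat) (v : 'I_m.+1 -> ratfun C) : 'rV[ratfun C]_m.+1 :=
  \row_i (if i == ord_max then tilde (v i) else v i).

Lemma frac_repr f : f = (\n_(repr f))%:F / (\d_(repr f))%:F.
Proof.
have dN0 : \d_(repr f) != 0 by exact: denom_ratioP.
apply: (canRL (mulfK _)); first by rewrite tofrac_eq0.
rewrite -{1}(reprK f); unlock FracField.tofrac.
rewrite -[LHS]FracField.pi_mul; apply/eqmodP.
rewrite /= FracField.equivfE /FracField.mulf !numden_Ratio ?oner_eq0 //.
  by rewrite !mulr1 mulrC.
all: by rewrite mulr1.
Qed.

Lemma lowest_terms_numf_denf f : lowest_terms (numf f) (denf f) f.
Proof.
rewrite /numf /denf; set r := repr f; set n := \n_r; set d := \d_r.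
have dN0 : d != 0 by exact: denom_ratioP.
have gN0 : gcdp n d != 0 by rewrite gcdp_eq0 negb_and dN0 orbT.
have nE : n = n %/ gcdp n d * gcdp n d by rewrite divpK // dvdp_gcdl.
have dE : d = d %/ gcdp n d * gcdp n d by rewrite divpK // dvdp_gcdr.
have d'N0 : d %/ gcdp n d != 0.
  by apply: contraNneq dN0 => e; rewrite dE e mul0r.
split=> //; first by apply: coprimep_div_gcd; rewrite dN0 orbT.
rewrite [LHS]frac_repr -/r -/n -/d.
apply/eqP; rewrite eqr_div ?tofrac_eq0 // -!tofracM tofrac_eq.
move: nE dE; set g := gcdp n d; set n' := n %/ g; set d' := d %/ g => nE dE.
by rewrite [X in X * _ == _]nE [X in _ == _ * X]dE -mulrA (mulrC g).
Qed.

Lemma feval_frac p q z : q.[z] != 0 -> feval (p%:F / q%:F) z = p.[z] / q.[z].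
Proof.
move=> qzN0; set f := _ / _.
have qN0 : q != 0 by apply: contraNneq qzN0 => ->; rewrite horner0.
have [cop dN0 fE] := lowest_terms_numf_denf f.
have e : p * denf f = numf f * q.
  apply/eqP; rewrite -tofrac_eq !tofracM; apply/eqP.
  have : p%:F / q%:F = (numf f)%:F / (denf f)%:F by [].
  by move/eqP; rewrite eqr_div ?tofrac_eq0 // => /eqP.
have dzN0 : (denf f).[z] != 0.
  apply: contraTneq isT => d0.
  have /(congr1 (fun p => p.[z])) := e; rewrite !hornerM d0 mulr0.
  move/esym/eqP; rewrite mulf_eq0 (negPf qzN0) orbF => n0.
  by have := coprimep_root cop n0; rewrite d0 eqxx.
apply/eqP; rewrite /feval eqr_div //.
have /(congr1 (fun p => p.[z])) := e; rewrite !hornerM => <-.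
by [].
Qed.

Lemma feval_tilde f z : z != 0 -> ~ pole f (z^*)^-1 ->
  feval (tilde f) z = (feval f (z^*)^-1)^*.
Proof.
move=> zN0 /negP; rewrite /pole /root => dN0.
have expVB (F : fieldType) (x : F) i n : x != 0 -> (i <= n)%N ->
    x^-1 ^+ i * x ^+ n = x ^+ (n - i).
  move=> xN0 le_in; rewrite -{1}(subnKC le_in) exprD mulrA -exprMn mulVf //.
  by rewrite expr1n mul1r.
pose k := maxn (size (numf f)) (size (denf f)).
pose rv (p : {poly C}) : {poly C} := \sum_(i < k) (p`_i)^* *: 'X^(k - i).
have XN0 : ('X%:F : ratfun C) != 0 by rewrite tofrac_eq0 polyX_eq0.
have rvE (p : {poly C}) : (size p <= k)%N -> tilde_poly p * 'X%:F ^+ k = (rv p)%:F.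
  move=> sp; rewrite /tilde_poly (@horner_coef_wide _ k); last first.
    exact: leq_trans (size_poly _ _) sp.
  rewrite mulr_suml rmorph_sum; apply: eq_bigr => i _ /=.
  rewrite coef_map_id0 ?conjC0 // -mul_polyC tofracM tofracXn -mulrA.
  by rewrite expVB // ltnW.
have rvz (p : {poly C}) : (size p <= k)%N -> (rv p).[z] = (p.[(z^*)^-1])^* * z ^+ k.
  move=> sp; rewrite (horner_coef_wide _ sp) horner_sum rmorph_sum mulr_suml.
  apply: eq_bigr => i _; rewrite hornerZ hornerXn rmorphM rmorphXn fmorphV /=.
  rewrite conjCK -mulrA; congr (_ * _).
  by rewrite expVB // ltnW.
have sn : (size (numf f) <= k)%N by rewrite leq_maxl.
have sd : (size (denf f) <= k)%N by rewrite leq_maxr.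
have -> : tilde f = (rv (numf f))%:F / (rv (denf f))%:F.
  by rewrite -!rvE // -mulf_div divff ?mulr1 // expf_neq0.
rewrite feval_frac !rvz //; last first.
  by rewrite mulf_neq0 ?expf_neq0 // fmorph_eq0.
by rewrite -mulf_div divff ?mulr1 ?expf_neq0 // /feval fmorph_div.
Qed.

End RationalFunctions.

Section ExactConstructions.
Variable m : nat.

(* Exact arithmetic on unknown scalars.  The data are m rational functions
   p_i / q_i, given by the coefficients of the polynomials p_i and q_i. *)
Inductive scalar : Type :=
| SNumCoef (i : 'I_m) (k : nat)
| SDenCoef (i : 'I_m) (k : nat)
| SNatCst (n : nat)
| SAdd (s t : scalar)
| SOpp (s : scalar)
| SMul (s t : scalar)
| SInv (s : scalar)
| SConj (s : scalar).

(* Finite branching computations.  A procedure can perform arithmetic and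
   zero tests only, which suffices for Gaussian elimination and for the
   coefficients of the Laurent expansion of a given quotient of polynomials at
   a given point; root extraction and root finding are not available. *)
Inductive procedure (A : Type) : Type :=
| Return (a : A)
| IfZero (s : scalar) (yes no : procedure A).

Variable C : numClosedFieldType.
Variables p q : 'I_m -> {poly C}.

Fixpoint seval (s : scalar) : C :=
  match s with
  | SNumCoef i k => (p i)`_k
  | SDenCoef i k => (q i)`_k
  | SNatCst n => n%:R
  | SAdd s t => seval s + seval t
  | SOpp s => - seval s
  | SMul s t => seval s * seval t
  | SInv s => (seval s)^-1
  | SConj s => (seval s)^*
  end.

Fixpoint run (A : Type) (P : procedure A) : A :=
  match P with
  | Return a => a
  | IfZero s P1 P2 => if seval s == 0 then run P1 else run P2
  end.

Definition peval (s : seq scalar) : {poly C} := Poly (map seval s).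

End ExactConstructions.

(* The coefficient lists of a numerator and a denominator for each entry of
   an m x m matrix of rational functions. *)
Definition symbolic_matrix (m : nat) : Type :=
  'I_m -> 'I_m -> seq (scalar m) * seq (scalar m).

(* On the data p_i / q_i, the procedure P constructs the matrix V: it finds
   coprime polynomials with quotient V i j, for all i and j. *)
Definition constructs (m : nat) (C : numClosedFieldType)
    (P : procedure m (symbolic_matrix m)) (p q : 'I_m -> {poly C})
    (V : 'M[ratfun C]_m) : Prop :=
  let W := run p q P in
  forall i j, lowest_terms (peval p q (W i j).1) (peval p q (W i j).2) (V i j).

(* Main.v *)
(* A unit vector x can be completed to a paraunitary matrix with no square root:
   1 - (1 - tilde x_0)^-1 w* w with w = x - e_0 is a quasi-reflection whose first
   row is x (Witt's theorem for the involution tilde); when x_0 = 1 one uses -e_0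
   in place of e_0.  The entries are thus given by field operations and conjugation
   on the coefficients of the data, and Euclid's algorithm, which needs only zero
   tests besides arithmetic, puts them in lowest terms. *)
From HB Require Import structures.
Require Import Defs.
From mathcomp Require Import all_boot all_order all_algebra.
From mathcomp Require Import all_reals.
From mathcomp Require Import complex ring zify.
Import Order.TTheory GRing.Theory Num.Theory.
Local Open Scope ring_scope.

Set Implicit Arguments.
Unset Strict Implicit.
Unset Printing Implicit Defensive.

(** * Quasi-reflections over a field with an involution *)

Section Reflection.
Variables (F : fieldType) (tau : {rmorphism F -> F}) (n : nat).
Hypothesis tauK : involutive tau.
Local Notation adj A := (map_mx tau A)^T.

(** Up to the sign [s], which will be 1 or -1, this is a quasi-reflection along [w]: row vectors
    orthogonal to [w] are multiplied by [s]. The choice of [s] keeps the denominator nonzero. *)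
Definition reflection (s : F) (x : 'rV[F]_n.+1) : 'M[F]_n.+1 :=
  let w := x - s *: delta_mx 0 0 in
  s%:M - (s - tau (x 0 0))^-1 *: (adj w *m w).

Lemma reflectionE s (x : 'rV[F]_n.+1) i j : tau s = s ->
  reflection s x i j = s * (i == j)%:R - (s - tau (x 0 0))^-1 *
    ((tau (x 0 i) - s * (i == 0)%:R) * (x 0 j - s * (j == 0)%:R)).
Proof.
move=> taus; rewrite !mxE big_ord1 !mxE /= rmorphB rmorphM taus rmorph_nat.
by rewrite -[s *+ _]mulr_natr.
Qed.

(** The first entry of [adj w] is [tau x_0 - s], so the rank-one term contributes exactly [w] to the
    first row, and [s e_0 + w = x]. *)
Lemma row_reflection s (x : 'rV[F]_n.+1) :
  tau s = s -> tau (x 0 0) != s -> row 0 (reflection s x) = x.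
Proof.
move=> taus x0; have d0 : s - tau (x 0 0) != 0 by rewrite subr_eq0 eq_sym.
apply/rowP=> j; rewrite !mxE big_ord1 !mxE eqxx /= mulr1 rmorphB taus.
rewrite [0 == j]eq_sym -mulr_natr.
by field.
Qed.

(** With [k] and [l] the inverses of [s - tau x_0] and [s - x_0], the adjoint has [l] in place of
    [k], and [w adj w = s (1/l + 1/k)]. The rank-one part of the product then has coefficient
    [- s (k + l) + k l s (1/l + 1/k) = 0]. *)
Lemma reflection_unitary s (x : 'rV[F]_n.+1) :
    s ^+ 2 = 1 -> tau s = s -> tau (x 0 0) != s -> x *m adj x = 1%:M ->
  reflection s x *m adj (reflection s x) = 1%:M.
Proof.
move=> s2 taus x0 xx; rewrite /reflection; set w := x - _.
have d0 : s - tau (x 0 0) != 0 by rewrite subr_eq0 eq_sym.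
have c0 : s - x 0 0 != 0.
  by rewrite -(fmorph_eq0 tau) rmorphB taus.
(* [x adj x = 1] and [s ^+ 2 = 1] turn the left side into [2 - s x_0 - s tau x_0], split here
   between the two denominators. *)
have ww : w *m adj w = (s * (s - x 0 0) + s * (s - tau (x 0 0)))%:M.
  apply/matrixP=> i j; rewrite !ord1 [LHS]mxE.
  have /matrixP/(_ 0 0) := xx; rewrite !mxE eqxx mulr1n big_ord_recl !mxE => xx0.
  rewrite big_ord_recl !mxE /= !mulr1 rmorphB taus.
  under eq_bigr => k _ do rewrite !mxE /= mulr0 subr0.
  have {}xx0 : \sum_(k < n) x 0 (lift ord0 k) * tau (x 0 (lift ord0 k))
      = 1 - x 0 0 * tau (x 0 0).
    rewrite -xx0 addrC addKr; apply: eq_bigr => k _.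
    by rewrite !mxE.
  rewrite xx0 -s2; ring.
set k := (s - _)^-1.
have -> : adj (s%:M - k *: (adj w *m w)) =
    s%:M - (s - x 0 0)^-1 *: (adj w *m w).
  rewrite map_mxB linearB /= map_scalar_mx tr_scalar_mx taus map_mxZ linearZ /=.
  rewrite map_mxM trmx_mul -map_trmx trmxK /k fmorphV rmorphB taus tauK.
  suff -> : map_mx tau (map_mx tau w) = w by [].
  by apply/matrixP=> i j; rewrite !mxE /= tauK.
set l := (_ - x 0 0)^-1; set A := adj w *m w.
have AA : A *m A = (s * (l^-1 + k^-1)) *: A.
  rewrite /A mulmxA -(mulmxA _ w) ww mul_mx_scalar -scalemxAl /l /k !invrK.
  by rewrite -mulrDr.
rewrite mulmxBl !mulmxBr -!scalemxAl -!scalemxAr AA.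
rewrite !mul_scalar_mx mul_mx_scalar !scalerA scale_scalar_mx -expr2 s2.
move: A {AA} => A; apply/matrixP=> i j; rewrite !mxE /k /l !invrK.
by field; rewrite c0 d0.
Qed.

End Reflection.

(** * The involution [tilde] on rational functions *)

Section Tilde.
Variable C : numClosedFieldType.
Implicit Types (p q : {poly C}) (f g : ratfun C).

(** Naming the coefficient map of [tilde_poly] lets it carry a ring morphism structure, which
    [tilde_poly] then inherits. *)
Definition conj_const (a : C) : ratfun C := (a^*)%:P%:F.

Fact conj_const_additive : zmod_morphism conj_const.
Proof. by move=> a b; rewrite /conj_const !rmorphB. Qed.
Fact conj_const_multiplicative : monoid_morphism conj_const.
Proof. by split=> [|a b]; rewrite /conj_const ?rmorph1 // !rmorphM. Qed.
HB.instance Definition _ :=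
  GRing.isZmodMorphism.Build C (ratfun C) conj_const conj_const_additive.
HB.instance Definition _ :=
  GRing.isMonoidMorphism.Build C (ratfun C) conj_const conj_const_multiplicative.

Fact tilde_poly_additive : zmod_morphism (@tilde_poly C).
Proof.
by move=> p q; rewrite /tilde_poly -/conj_const rmorphB hornerD hornerN.
Qed.
Fact tilde_poly_multiplicative : monoid_morphism (@tilde_poly C).
Proof.
split=> [|p q]; rewrite /tilde_poly -/conj_const ?rmorph1 ?hornerC //.
by rewrite rmorphM hornerM.
Qed.
HB.instance Definition _ :=
  GRing.isZmodMorphism.Build {poly C} (ratfun C) (@tilde_poly C)
    tilde_poly_additive.
HB.instance Definition _ :=
  GRing.isMonoidMorphism.Build {poly C} (ratfun C) (@tilde_poly C)
    tilde_poly_multiplicative.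

Lemma tilde_polyC a : tilde_poly a%:P = conj_const a.
Proof. by rewrite /tilde_poly -/conj_const map_polyC hornerC. Qed.

Lemma tilde_polyX : tilde_poly 'X = ('X%:F)^-1 :> ratfun C.
Proof. by rewrite /tilde_poly -/conj_const map_polyX hornerX. Qed.

(** The reciprocal polynomial [z^N conj(p(1/conj z))], taken at a nominal degree [N] so that one
    formula serves all polynomials under a common bound. *)
Definition revconj (N : nat) p : {poly C} := \poly_(k < N.+1) (p`_(N - k))^*.

Lemma tilde_poly_revconj N p : (size p <= N.+1)%N ->
  tilde_poly p * 'X%:F ^+ N = (revconj N p)%:F.
Proof.
move=> sp; have X0 : ('X%:F : ratfun C) != 0 by rewrite tofrac_eq0 polyX_eq0.
rewrite /tilde_poly -/conj_const (@horner_coef_wide _ N.+1); last first.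
  exact: leq_trans (size_poly _ _) sp.
rewrite mulr_suml /revconj poly_def rmorph_sum (reindex_inj rev_ord_inj) /=.
apply: eq_bigr => i _; have iN : (i <= N)%N by rewrite -ltnS.
rewrite subSS coef_map /conj_const -mul_polyC !tofracM tofracXn -mulrA.
congr (_ * _); rewrite exprVn; apply: (canLR (mulKf _)); first exact: expf_neq0.
by rewrite -exprD subnK.
Qed.

Lemma revconj_eq0 N p : (size p <= N.+1)%N -> (revconj N p == 0) = (p == 0).
Proof.
move=> sp; apply/eqP/eqP => [r0|->]; last first.
  by apply/polyP=> i; rewrite coef_poly coef0 conjC0 if_same coef0.
apply/polyP=> i; rewrite coef0; have [iN|iN] := leqP i N; last first.
  by rewrite nth_default // (leq_trans sp).
have /(congr1 (fun r : {poly C} => r`_(N - i))) := r0.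
rewrite coef_poly coef0 ltnS leq_subr subKn // => /eqP.
by rewrite conjC_eq0 => /eqP.
Qed.

Lemma tilde_poly_eq0 p : (tilde_poly p == 0) = (p == 0).
Proof.
have sp := leqnSn (size p).
rewrite -(revconj_eq0 sp) -(tofrac_eq0 (revconj _ _)) -(tilde_poly_revconj sp).
by rewrite mulf_eq0 expf_eq0 (tofrac_eq0 'X) polyX_eq0 andbF orbF.
Qed.

(** By cross-multiplication, [tilde] can be computed from any representative, not only from the
    reduced one of its definition. The ring morphism laws follow from this. *)
Lemma tilde_frac p q : q != 0 ->
  tilde (p%:F / q%:F) = tilde_poly p / tilde_poly q.
Proof.
move=> q0; set f := _ / _; have [_ d0 fE] := lowest_terms_numf_denf f.
rewrite /tilde; apply/eqP; rewrite eqr_div ?tilde_poly_eq0 // -!rmorphM /=.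
apply/eqP; congr tilde_poly; apply/eqP; rewrite -tofrac_eq !tofracM.
by rewrite -eqr_div ?tofrac_eq0 // -fE.
Qed.

Lemma fractionP f : exists p q, q != 0 /\ f = p%:F / q%:F.
Proof.
by have [_ d0 fE] := lowest_terms_numf_denf f; exists (numf f), (denf f).
Qed.

Fact tilde_additive : zmod_morphism (@tilde C).
Proof.
move=> f g; have [p [q [q0 ->]]] := fractionP f.
have [p' [q' [q'0 ->]]] := fractionP g.
rewrite -mulNr -tofracN addf_div ?tofrac_eq0 // -!tofracM -tofracD.
rewrite !tilde_frac ?mulf_neq0 // -mulNr -rmorphN addf_div ?tilde_poly_eq0 //.
by rewrite rmorphD !rmorphM.
Qed.
Fact tilde_multiplicative : monoid_morphism (@tilde C).
Proof.
split=> [|f g].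
  have -> : (1 : ratfun C) = 1%:F / 1%:F by rewrite tofrac1 divr1.
  by rewrite tilde_frac ?oner_eq0 // !rmorph1.
have [p [q [q0 ->]]] := fractionP f.
have [p' [q' [q'0 ->]]] := fractionP g.
by rewrite mulf_div -!tofracM !tilde_frac ?mulf_neq0 // !rmorphM mulf_div.
Qed.
HB.instance Definition _ :=
  GRing.isZmodMorphism.Build (ratfun C) (ratfun C) (@tilde C) tilde_additive.
HB.instance Definition _ :=
  GRing.isMonoidMorphism.Build (ratfun C) (ratfun C) (@tilde C)
    tilde_multiplicative.

Lemma tilde_tofrac p : tilde p%:F = tilde_poly p.
Proof.
have -> : p%:F = p%:F / 1%:F :> ratfun C by rewrite tofrac1 divr1.
by rewrite tilde_frac ?oner_eq0 // rmorph1 divr1.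
Qed.

(** Polynomials suffice, by induction on the Horner form: constants are conjugated twice and ['X] is
    inverted twice. *)
Lemma tildeK : involutive (@tilde C).
Proof.
have pK p : tilde (tilde_poly p) = p%:F.
  elim/poly_ind: p => [|p c IHp]; first by rewrite !rmorph0.
  rewrite rmorphD rmorphM [tilde _]rmorphD rmorphM /= IHp tilde_polyC.
  rewrite tilde_polyX fmorphV /= !tilde_tofrac tilde_polyX tilde_polyC invrK.
  by rewrite /conj_const conjCK tofracD tofracM.
move=> f; have [p [q [q0 ->]]] := fractionP f.
by rewrite tilde_frac // fmorph_div /= !pK.
Qed.

Lemma tilde_revconj N p q : (size p <= N)%N -> (size q <= N)%N -> q != 0 ->
  tilde (p%:F / q%:F) = (revconj N p)%:F / (revconj N q)%:F.
Proof.
move=> sp sq q0; rewrite tilde_frac // -!tilde_poly_revconj ?leqW //.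
by rewrite -mulf_div divff ?mulr1 // expf_neq0 // tofrac_eq0 polyX_eq0.
Qed.

Lemma mxtildeE m n (A : 'M[ratfun C]_(m, n)) : mxtilde A = (map_mx (@tilde C) A)^T.
Proof. by apply/matrixP=> i j; rewrite !mxE. Qed.

End Tilde.

(** * Procedures and arithmetic on symbolic coefficient lists *)

Fixpoint bind {m : nat} {A B : Type} (P : procedure m A)
    (f : A -> procedure m B) : procedure m B :=
  match P with
  | Return a => f a
  | IfZero s P1 P2 => IfZero s (bind P1 f) (bind P2 f)
  end.

Section Procedures.
Variables (m : nat) (C : numClosedFieldType).
Implicit Types (p q : 'I_m -> {poly C}) (a b l u v s t : seq (Defs.scalar m)).

Lemma run_bind (A B : Type) p q (P : procedure m A) (f : A -> procedure m B) :
  run p q (bind P f) = run p q (f (run p q P)).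
Proof. by elim: P => //= c P1 IH1 P2 IH2; case: ifP. Qed.

Lemma peval_cons p q c l :
  peval p q (c :: l) = peval p q l * 'X + (seval p q c)%:P.
Proof. by rewrite /peval /= cons_poly_def. Qed.

Lemma peval_const p q c : peval p q [:: c] = (seval p q c)%:P.
Proof. by rewrite peval_cons /peval /= mul0r add0r. Qed.

Lemma coef_peval p q l k :
  (peval p q l)`_k = if (k < size l)%N then seval p q (nth (SNatCst m 0) l k) else 0.
Proof.
rewrite coef_Poly; case: ltnP => kl; last by rewrite nth_default ?size_map.
by rewrite (nth_map (SNatCst m 0)).
Qed.

Lemma size_peval p q l : (size (peval p q l) <= size l)%N.
Proof. by rewrite (leq_trans (size_Poly _)) ?size_map. Qed.

(** Drops formal coefficients known to evaluate to zero, so that the formal length, on which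
    Euclid's algorithm recurses, can decrease. *)
Lemma peval_take p q n l : (size (peval p q l) <= n)%N ->
  peval p q (take n l) = peval p q l.
Proof.
move=> sl; apply/polyP=> k; have [kn|nk] := ltnP k n; last first.
  rewrite [RHS]nth_default ?(leq_trans sl) //.
  rewrite nth_default // (leq_trans (size_peval _ _ _)) //.
  by rewrite (leq_trans _ nk) // size_take geq_minl.
by rewrite !coef_peval size_take_min leq_min kn nth_take.
Qed.

(** The list is chosen before the data [p] and [q]; this uniformity lets it occur inside a
    procedure. *)
Lemma peval_add a b : exists l, forall p q,
  peval p q l = peval p q a + peval p q b.
Proof.
elim: a b => [|x a IHa] [|y b].
- by exists [::] => p q; rewrite /peval /= addr0.
- by exists (y :: b) => p q; rewrite /peval /= add0r.
- by exists (x :: a) => p q; rewrite /peval /= addr0.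
have [l lE] := IHa b; exists (SAdd x y :: l) => p q.
by rewrite !peval_cons lE /= polyCD; ring.
Qed.

Lemma peval_mul a b : exists l, forall p q,
  peval p q l = peval p q a * peval p q b.
Proof.
elim: a => [|x a [l lE]]; first by exists [::] => p q; rewrite /peval /= mul0r.
have [l' l'E] : exists l', forall p q, peval p q l' = (seval p q x)%:P * peval p q b.
  exists (map (SMul x) b) => p q; elim: b {l lE} => [|y b IHb].
    by rewrite /peval /= mulr0.
  by rewrite /= !peval_cons IHb /= polyCM; ring.
have [l2 l2E] := peval_add l' (SNatCst m 0 :: l); exists l2 => p q.
by rewrite l2E l'E !peval_cons lE /= polyC0; ring.
Qed.

(** One elimination step of polynomial long division. *)
Lemma peval_subMXn c k a b : exists l, forall p q,
  peval p q l = peval p q a - (seval p q c)%:P * 'X^k * peval p q b.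
Proof.
have [l1 l1E] := peval_mul [:: SOpp c] b.
have [l2 l2E] := peval_add a (ncons k (SNatCst m 0) l1); exists l2 => p q.
rewrite l2E; have -> : peval p q (ncons k (SNatCst m 0) l1) = 'X^k * peval p q l1.
  elim: k {l2 l2E} => [|k IHk]; first by rewrite expr0 mul1r.
  by rewrite /= peval_cons IHk /= polyC0 addr0 exprS; ring.
by rewrite l1E peval_const /= polyCN; ring.
Qed.

(** * Euclid's algorithm on coefficient lists *)

Lemma size_leq_pred n (f : {poly C}) :
  (size f <= n)%N -> f`_n.-1 = 0 -> (size f <= n.-1)%N.
Proof.
move=> sf f0; apply/leq_sizeP => k; rewrite leq_eqVlt => /predU1P[<-//|nk].
by apply: nth_default; rewrite (leq_trans sf) // (leq_trans (leqSpred n)).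
Qed.

(* A state of Euclid's algorithm on A and B: the remainders [a] and [b] come with
   cofactors whose matrix is unimodular, so that the cofactors of a vanishing
   remainder are the reduced fraction A / B. *)
Definition reducible a b u v s t : Prop :=
  exists P : procedure m (seq (Defs.scalar m) * seq (Defs.scalar m)),
  forall p q (A B : {poly C}), B != 0 ->
    peval p q u * A = peval p q v * B + peval p q a ->
    peval p q s * A = peval p q t * B + peval p q b ->
    (peval p q u * peval p q t - peval p q v * peval p q s) ^+ 2 = 1 ->
  lowest_terms (peval p q (run p q P).1) (peval p q (run p q P).2)
    (A%:F / B%:F).

(** The swap changes the sign of the determinant, hence the square in the invariant. *)
Lemma reducible_sym a b u v s t : reducible a b u v s t -> reducible b a s t u v.
Proof.
by move=> [P PE]; exists P => p q A B B0 e1 e2 d; apply: PE => //; rewrite -d; ring.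
Qed.

(** Here [S A = T B], and the determinant condition is a Bezout relation between [T] and [S]; thus
    [T / S] is the reduced form of [A / B]. *)
Lemma reducible_nil a u v s t : reducible a [::] u v s t.
Proof.
exists (Return m (t, s)) => p q A B B0 _ /= e.
rewrite [peval _ _ [::]]/peval /= addr0 in e.
move: (peval p q u) (peval p q v) (peval p q s) (peval p q t) e => U V S T e d.
have cop : coprimep T S.
  apply/Bezout_coprimepP; exists (U * (U * T - V * S), - V * (U * T - V * S)).
  by rewrite /= (_ : _ + _ = 1) ?eqpxx // -d; ring.
(* If [S] were zero, [T B = 0] would force [T = 0], against coprimality. *)
have S0 : S != 0.
  apply: contraTneq cop => S0; move: e; rewrite S0 mul0r coprimep0.
  move/esym/eqP; rewrite mulf_eq0 (negPf B0) orbF => /eqP ->.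
  by rewrite -size_poly_eq1 size_poly0.
split=> //; apply/eqP; rewrite eqr_div ?tofrac_eq0 // -!tofracM tofrac_eq.
by rewrite mulrC e.
Qed.

(** Induction on the total formal length. The true degrees are unknown in advance, so the last
    formal coefficient of [b] is tested: if zero it is dropped, otherwise it serves to cancel the
    last one of [a]. Either branch shortens a list. *)
Lemma reducible_all a b u v s t : reducible a b u v s t.
Proof.
elim: {a b}(size a + size b)%N {-2}a {-2}b (leqnn (size a + size b)) u v s t.
  move=> a b; rewrite leqn0 addn_eq0 => /andP[_ /nilP ->] *.
  exact: reducible_nil.
move=> n IHn a b le_n u v s t.
wlog ba : a b le_n u v s t / (size b <= size a)%N => [wl|].
  have [ba|/ltnW ab] := leqP (size b) (size a); first exact: wl.
  by apply: reducible_sym; apply: wl => //; rewrite addnC.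
have [/size0nil ->|b_gt0] := posnP (size b); first exact: reducible_nil.
have a_gt0 := leq_trans b_gt0 ba.
set la := nth (SNatCst m 0) a (size a).-1.
set lb := nth (SNatCst m 0) b (size b).-1.
have takeP (l : seq (Defs.scalar m)) k : (size (take k l) <= k)%N.
  by rewrite size_take_min geq_minl.
have [|P0 P0E] := IHn a (take (size b).-1 b) _ u v s t.
  rewrite -ltnS (leq_trans _ le_n) // ltn_add2l (leq_ltn_trans (takeP _ _)) //.
  by rewrite prednK.
(* The single quotient term [c 'X^k] is subtracted from the remainder and from both cofactors
   alike. *)
pose c := SMul la (SInv lb); pose k := (size a - size b)%N.
have [a' a'E] := peval_subMXn c k a b.
have [u' u'E] := peval_subMXn c k u s.
have [v' v'E] := peval_subMXn c k v t.
have [|P1 P1E] := IHn (take (size a).-1 a') b _ u' v' s t.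
  rewrite -ltnS (leq_trans _ le_n) // ltn_add2r (leq_ltn_trans (takeP _ _)) //.
  by rewrite prednK.
exists (IfZero lb P0 P1) => p q A B B0 e1 e2 d /=.
have [lb0|lb0] := eqVneq (seval p q lb) 0.
  apply: P0E => //; rewrite peval_take // size_leq_pred ?size_peval //.
  by rewrite coef_peval prednK // leqnn.
(* Subtracting a multiple of the second row of cofactors from the first preserves the
   determinant. *)
apply: P1E => //; last by rewrite -d u'E v'E; ring.
rewrite peval_take; first by rewrite u'E v'E a'E mulrBl e1 -!mulrA e2; ring.
rewrite a'E; apply: size_leq_pred.
  rewrite (leq_trans (size_polyD _ _)) // geq_max size_peval size_polyN.
  rewrite -mulrA mul_polyC (leq_trans (size_scale_leq _ _)) //.
  rewrite (leq_trans (size_polyMleq _ _)) // size_polyXn addSn /=.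
  by rewrite -(subnK ba) leq_add2l size_peval.
(* At the last formal index of [a], the shifted [b] shows its own last formal coefficient, and the
   two terms cancel. *)
have kE : ((size a).-1 - k)%N = (size b).-1 by rewrite /k; lia.
rewrite coefB -mulrA coefCM coefXnM kE ifF; last by rewrite /k; lia.
by rewrite !coef_peval !prednK // !leqnn /= divfK // subrr.
Qed.

(** * Computability uniform in the data, under a guard [G] that zero tests refine *)

Definition computable {A : Type}
    (G : ('I_m -> {poly C}) -> ('I_m -> {poly C}) -> Prop)
    (spec : ('I_m -> {poly C}) -> ('I_m -> {poly C}) -> A -> Prop) : Prop :=
  exists P : procedure m A, forall p q, G p q -> spec p q (run p q P).

Definition rational (G : ('I_m -> {poly C}) -> ('I_m -> {poly C}) -> Prop)
    (f : ('I_m -> {poly C}) -> ('I_m -> {poly C}) -> ratfun C) : Prop :=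
  exists a b, forall p q, G p q ->
    peval p q b != 0 /\ f p q = (peval p q a)%:F / (peval p q b)%:F.

(** The procedures run one after the other along an enumeration of [I]; [a0] fills the indices not
    yet reached. *)
Lemma computable_forall {A : Type} (I : finType) G
    (spec : I -> ('I_m -> {poly C}) -> ('I_m -> {poly C}) -> A -> Prop) (a0 : A) :
  (forall i, computable G (spec i)) ->
  computable G (fun p q (f : I -> A) => forall i, spec i p q (f i)).
Proof.
move=> specP.
suff /(_ (enum I)) [P PE] : forall r : seq I, computable G
    (fun p q (f : I -> A) => forall i, i \in r -> spec i p q (f i)).
  by exists P => p q Gpq i; apply: PE => //; rewrite mem_enum.
elim=> [|i r [P PE]]; first by exists (Return m (fun=> a0)).
have [Q QE] := specP i.
exists (bind Q (fun y => bind P (fun f =>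
  Return m (fun j => if j == i then y else f j)))) => p q Gpq j.
rewrite !run_bind /= inE; case: eqVneq => [-> _|_ jr]; first exact: QE.
exact: PE.
Qed.

Lemma run_eq0 l : exists P : procedure m bool, forall p q,
  run p q P = (peval p q l == 0).
Proof.
elim: l => [|c l [P PE]].
  by exists (Return m true) => p q; rewrite /peval eqxx.
exists (IfZero c P (Return m false)) => p q /=; rewrite peval_cons.
have [->|c0] := eqVneq (seval p q c) 0.
  by rewrite PE polyC0 addr0 mulf_eq0 polyX_eq0 orbF.
apply/esym/negP => /eqP/(congr1 (fun r : {poly C} => r`_0)).
by rewrite coefD coefMX coefC coef0 add0r => /eqP; rewrite (negPf c0).
Qed.

(** Testing the numerator of [f] suffices, as its denominator is nonzero under [G]; each branch adds
    the outcome to its guard. *)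
Lemma computable_if_eq0 {A : Type} G f
    (spec : ('I_m -> {poly C}) -> ('I_m -> {poly C}) -> A -> Prop) :
    rational G f ->
    computable (fun p q => G p q /\ f p q = 0) spec ->
    computable (fun p q => G p q /\ f p q != 0) spec ->
  computable G spec.
Proof.
move=> [a [b fE]] [P1 P1E] [P2 P2E]; have [T TE] := run_eq0 a.
exists (bind T (fun c : bool => if c then P1 else P2)) => p q Gpq.
have [b0 fpq] := fE _ _ Gpq.
have f0 : (f p q == 0) = (peval p q a == 0).
  by rewrite fpq mulf_eq0 invr_eq0 !tofrac_eq0 (negPf b0) orbF.
rewrite run_bind TE -f0; case: eqVneq => f0'; first exact: P1E.
exact: P2E.
Qed.

Lemma computable_lowest_terms G f : rational G f ->
  computable G (fun p q r => lowest_terms (peval p q r.1) (peval p q r.2) (f p q)).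
Proof.
move=> [a [b fE]].
(* Initial state: [1 A = 0 B + A] and [0 A = - 1 B + B], of determinant -1. *)
have [P PE] := reducible_all a b [:: SNatCst m 1] [:: SNatCst m 0]
  [:: SNatCst m 0] [:: SOpp (SNatCst m 1)].
exists P => p q /fE [b0 ->]; apply: PE => //; rewrite !peval_const /=.
- by rewrite polyC0 mul0r mul1r add0r.
- by rewrite polyC0 polyCN mul0r mulN1r addNr.
- by rewrite polyC0 polyCN mul0r mul1r subr0 sqrrN expr1n.
Qed.

(** * Closure of rational expressions under field operations *)

Section Rational.
Variable G : ('I_m -> {poly C}) -> ('I_m -> {poly C}) -> Prop.
Implicit Types f g : ('I_m -> {poly C}) -> ('I_m -> {poly C}) -> ratfun C.

Lemma rational_sub (G' : ('I_m -> {poly C}) -> ('I_m -> {poly C}) -> Prop) f :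
  (forall p q, G' p q -> G p q) -> rational G f -> rational G' f.
Proof. by move=> GG [a [b fE]]; exists a, b => p q /GG /fE. Qed.

Lemma eq_rational f g :
  rational G f -> (forall p q, G p q -> f p q = g p q) -> rational G g.
Proof.
move=> [a [b fE]] fg; exists a, b => p q Gpq.
by have [b0 <-] := fE _ _ Gpq; rewrite fg.
Qed.

Lemma rational_nat k : rational G (fun _ _ => k%:R).
Proof.
exists [:: SNatCst m k], [:: SNatCst m 1] => p q _; rewrite !peval_const /=.
by rewrite oner_eq0 polyC1 tofrac1 divr1 !rmorph_nat.
Qed.

Lemma rationalN f : rational G f -> rational G (fun p q => - f p q).
Proof.
move=> [a [b fE]]; have [l lE] := peval_mul [:: SOpp (SNatCst m 1)] a.
exists l, b => p q /fE [b0 ->]; split=> //.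
by rewrite lE peval_const /= polyCN mulN1r tofracN mulNr.
Qed.

Lemma rationalD f g : rational G f -> rational G g ->
  rational G (fun p q => f p q + g p q).
Proof.
move=> [a [b fE]] [a' [b' gE]]; have [l lE] := peval_mul a b'.
have [l' l'E] := peval_mul a' b; have [n nE] := peval_add l l'.
have [d dE] := peval_mul b b'; exists n, d => p q Gpq.
have [b0 ->] := fE _ _ Gpq; have [b'0 ->] := gE _ _ Gpq.
rewrite dE mulf_neq0 //; split=> //.
by rewrite nE lE l'E tofracD !tofracM addf_div ?tofrac_eq0.
Qed.

Lemma rationalB f g : rational G f -> rational G g ->
  rational G (fun p q => f p q - g p q).
Proof. by move=> rf rg; apply: rationalD => //; apply: rationalN. Qed.

Lemma rationalM f g : rational G f -> rational G g ->
  rational G (fun p q => f p q * g p q).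
Proof.
move=> [a [b fE]] [a' [b' gE]]; have [n nE] := peval_mul a a'.
have [d dE] := peval_mul b b'; exists n, d => p q Gpq.
have [b0 ->] := fE _ _ Gpq; have [b'0 ->] := gE _ _ Gpq.
by rewrite dE mulf_neq0 // nE !tofracM mulf_div.
Qed.

Lemma rationalV f : (forall p q, G p q -> f p q != 0) -> rational G f ->
  rational G (fun p q => (f p q)^-1).
Proof.
move=> f0 [a [b fE]]; exists b, a => p q Gpq; have [b0 fpq] := fE _ _ Gpq.
split; last by rewrite fpq invf_div.
by apply: contraNneq (f0 _ _ Gpq) => a0; rewrite fpq a0 tofrac0 mul0r.
Qed.

End Rational.

(** A procedure is a finite tree and reads finitely many coefficients, hence the bound [N] fixed
    before the data. *)
Definition admissible (N : nat) p q : Prop :=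
  (forall i, (size (p i) <= N)%N /\ (size (q i) <= N)%N) /\ forall i, q i != 0.

Lemma rational_entry N i :
  rational (admissible N) (fun p q => (p i)%:F / (q i)%:F).
Proof.
have coefs (f : nat -> Defs.scalar m) p q (r : {poly C}) :
    (size r <= N)%N -> (forall k, seval p q (f k) = r`_k) ->
    peval p q (mkseq f N) = r.
  move=> sr fE; apply/polyP=> k; rewrite coef_peval size_mkseq.
  by case: ltnP => kN; [rewrite nth_mkseq | rewrite nth_default ?(leq_trans sr)].
exists (mkseq (SNumCoef i) N), (mkseq (SDenCoef i) N) => p q [sz q0].
have [sp sq] := sz i.
by rewrite (@coefs (SNumCoef i) _ _ (p i)) // (@coefs (SDenCoef i) _ _ (q i)).
Qed.

Lemma rational_tilde_entry N i :
  rational (admissible N) (fun p q => tilde ((p i)%:F / (q i)%:F)).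
Proof.
have coefs (f : nat -> Defs.scalar m) p q (r : {poly C}) :
    (forall k, seval p q (f k) = r`_k) ->
    peval p q (mkseq (fun k => SConj (f (N - k)%N)) N.+1) = revconj N r.
  move=> fE; apply/polyP=> k; rewrite coef_peval size_mkseq coef_poly.
  by case: ltnP => kN //; rewrite nth_mkseq //= fE.
(* The lists follow [revconj N], hence the length [N.+1]; at [k = 0] they read the coefficient of
   index [N], which the size bound makes zero. *)
exists (mkseq (fun k => SConj (SNumCoef i (N - k)%N)) N.+1),
  (mkseq (fun k => SConj (SDenCoef i (N - k)%N)) N.+1) => p q [sz q0].
have [sp sq] := sz i.
rewrite (@coefs (SNumCoef i) _ _ (p i)) // (@coefs (SDenCoef i) _ _ (q i)) //.
rewrite revconj_eq0 ?leqW //.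
by rewrite (@tilde_revconj _ N).
Qed.

End Procedures.

(** * Completion of a unit row to a paraunitary matrix *)

Lemma computable_completion (C : numClosedFieldType) (m N : nat) :
  computable (fun p q => admissible N p q /\
      let x := first_row (fun i => (p i)%:F / (q i)%:F) in x *m mxtilde x = 1%:M)
    (fun p q (W : symbolic_matrix m.+1) => exists V : 'M[ratfun C]_m.+1,
      [/\ paraunitary V, row ord0 V = first_row (fun i => (p i)%:F / (q i)%:F)
        & forall i j,
          lowest_terms (peval p q (W i j).1) (peval p q (W i j).2) (V i j)]).
Proof.
set G := fun p q => _ /\ _.
pose x (p q : 'I_m.+1 -> {poly C}) := first_row (fun i => (p i)%:F / (q i)%:F).
have rx i : rational G (fun p q => x p q 0 i).
  apply: (@rational_sub _ _ (admissible N)) => [p q []//|].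
  have [e|e] := eqVneq i ord_max.
    apply: (eq_rational (@rational_tilde_entry _ _ N i)) => p q _.
    by rewrite mxE e eqxx.
  by apply: (eq_rational (@rational_entry _ _ N i)) => p q _; rewrite mxE (negPf e).
have rtx i : rational G (fun p q => tilde (x p q 0 i)).
  apply: (@rational_sub _ _ (admissible N)) => [p q []//|].
  have [e|e] := eqVneq i ord_max.
    apply: (eq_rational (@rational_entry _ _ N i)) => p q _.
    by rewrite mxE e eqxx tildeK.
  apply: (eq_rational (@rational_tilde_entry _ _ N i)) => p q _.
  by rewrite mxE (negPf e).
(* Both signs [s] are treated at once, under a guard that makes the denominator of the reflection
   nonzero. *)
suff completion (G' : _ -> _ -> Prop) (s : ratfun C) :
    (forall p q, G' p q -> G p q /\ s - tilde (x p q 0 0) != 0) ->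
    s ^+ 2 = 1 -> tilde s = s -> rational G' (fun _ _ => s) ->
    computable G' (fun p q (W : symbolic_matrix m.+1) =>
      exists V : 'M[ratfun C]_m.+1, [/\ paraunitary V, row ord0 V = x p q
        & forall i j,
          lowest_terms (peval p q (W i j).1) (peval p q (W i j).2) (V i j)]).
  have r1 H : rational H (fun _ _ : 'I_m.+1 -> {poly C} => 1 : ratfun C).
    exact: (rational_nat H 1).
  apply: (@computable_if_eq0 _ _ _ _ (fun p q => 1 - tilde (x p q 0 0))).
  - exact: rationalB (r1 _) (rtx _).
  - apply: (completion _ (-1)).
    (* In this branch [tilde x_0 = 1], so [-1 - tilde x_0 = -2], nonzero in characteristic 0. *)
    + move=> p q [Gpq e]; split=> //; rewrite -[tilde _](subKr 1) e subr0.
      rewrite -opprD oppr_eq0 -tofrac1 -tofracD tofrac_eq0 -polyC1 -polyCD.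
      by rewrite polyC_eq0 -mulr2n pnatr_eq0.
    + by rewrite sqrrN expr1n.
    + by rewrite rmorphN1.
    + exact: (rationalN (r1 _)).
  - by apply: (completion _ 1); rewrite ?expr1n ?rmorph1.
move=> G'G s2 ts rs.
(* Each entry is reduced by its own run of Euclid's algorithm, indexed by the pair of its row and
   column. *)
have [|P PE] := @computable_forall m.+1 C _ ('I_m.+1 * 'I_m.+1)%type G'
  (fun ij p q r => lowest_terms (peval p q r.1) (peval p q r.2)
    (reflection (@tilde C) s (x p q) ij.1 ij.2)) ([::], [::]).
  move=> [i j]; apply: computable_lowest_terms.
  apply: eq_rational; last by move=> p q _; rewrite reflectionE.
  have rG f : rational G f -> rational G' f.
    by apply: rational_sub => p q /G'G [].
  have rn k : rational G' (fun _ _ => k%:R) by exact: rational_nat.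
  apply: rationalB (rationalM rs (rn _)) _; apply: rationalM.
    by apply: rationalV => [p q /G'G []//|]; apply: rationalB rs (rG _ (rtx _)).
  apply: rationalM; first exact: rationalB (rG _ (rtx _)) (rationalM rs (rn _)).
  exact: rationalB (rG _ (rx _)) (rationalM rs (rn _)).
exists (bind P (fun W => Return m.+1 (fun i j => W (i, j)))) => p q G'pq.
have [[_ xx] x0] := G'G _ _ G'pq.
have {}x0 : tilde (x p q 0 0) != s by rewrite eq_sym -subr_eq0.
exists (reflection (@tilde C) s (x p q)); split.
- rewrite /paraunitary mxtildeE; apply: reflection_unitary => //.
    exact: tildeK.
  by rewrite -mxtildeE.
- exact: row_reflection.
by move=> i j; rewrite run_bind /=; apply: (PE _ _ G'pq (i, j)).
Qed.

Local Open Scope complex_scope.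

Theorem theorem1p3 (R : realType) (m N : nat) :
  exists P : procedure m.+1 (symbolic_matrix m.+1),
  forall (v : 'I_m.+1 -> ratfun R[i]) (p q : 'I_m.+1 -> {poly R[i]}),
    (forall i, lowest_terms (p i) (q i) (v i)) ->
    (forall i, (size (p i) <= N)%N /\ (size (q i) <= N)%N) ->
    (forall i, Rplus (v i)) ->
    first_row v *m mxtilde (first_row v) = 1%:M ->
    (forall z : R[i], `|z| < 1 -> 0 < \sum_(i < m.+1) `|feval (v i) z|) ->
    exists V : 'M[ratfun R[i]]_m.+1,
      [/\ paraunitary V, row ord0 V = first_row v & constructs P p q V].
Proof.
have [P PE] := computable_completion R[i] m N.
exists P => v p q vE sz _ xx _.
have xE : first_row v = first_row (fun i => (p i)%:F / (q i)%:F).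
  by apply/rowP=> i; rewrite !mxE; have [_ _ ->] := vE i.
rewrite xE in xx *; apply: PE; split=> //; split=> // i.
by have [] := vE i.
Qed.
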